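(* Let $V$ be a countably-Hilbert space that has a countable dense subset, with dual $V'$. Then the $\sigma$-fields on $V'$ generated by the inductive limit topology, by the strong topology, and by the weak topology are equal.
   Context: A countably-normed space is a topological vector space $V$ over $\mathbb{C}$ whose topology is generated by a countable family of norms $\{|\cdot|_n : n=1,2,\dots\}$. It is a countably-Hilbert space if moreover each $|\cdot|_n$ is an inner product norm and $V$ is complete. The norms are taken to be increasing, $|v|_1\le |v|_2\le\cdots$ for all $v\in V$; $V_n$ denotes the completion of $V$ in $|\cdot|_n$, and the natural maps are regarded as inclusions $V\subset\cdots\subset V_{n+1}\subset V_n\subset\cdots\subset V_1$. $V'$ is the space of continuous linear functionals on $V$, with pairing $\langle v',v\rangle$; $V_n'$ is the dual of the Banach space $V_n$ with its operator norm $|\cdot|_{-n}$, regarded as a subspace of $V'$ by restricting functionals to $V$; one has $V'=\bigcup_n V_n'$. Topologies on $V'$: - The weak topology is the coarsest vector topology on $V'$ for which $v'\mapsto\langle v',v\rangle$ is continuous for every $v\in V$. - The strong topology has as a base of neighborhoods of $0$ the sets $\{v'\in V' : \sup_{v\in D}|\langle v',v\rangle|<\varepsilon\}$, with $D$ a bounded subset of $V$ and $\varepsilon>0$. ($D\subset V$ is bounded if for every neighborhood $U$ of $0$ there is $\lambda>0$ with $D\subset\lambda U$.) - The inductive limit topology is the finest locally convex vector topology on $V'=\bigcup_n V_n'$ for which every inclusion $V_n'\to V'$ is continuous ($V_n'$ carrying the norm $|\cdot|_{-n}$). The $\sigma$-field generated by a topology is the smallest $\sigma$-field containing all its open sets.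 *)

(* Defs.v *)
From HB Require Import structures.
From mathcomp Require Import all_boot all_order all_algebra.
From mathcomp Require Import sesquilinear complex.
From mathcomp Require Import all_classical all_reals all_analysis.

Set Implicit Arguments.
Unset Strict Implicit.
Unset Printing Implicit Defensive.

Import Order.TTheory GRing.Theory Num.Theory.
Import numFieldNormedType.Exports.

Local Notation normc := Normc.normc.

Local Open Scope classical_set_scope.
Local Open Scope complex_scope.
Local Open Scope ring_scope.

(** * Topologies on a fixed set

A set is equipped here with several topologies at the same time, so that a
topology is an explicit object [T]; [topologized T] is the same set, seen as
an instance of [topologicalType]. *)

Record is_topology (E : Type) (O : set_system E) : Prop := {
  is_topologyT : O setT;
  is_topologyI : setI_closed O;
  is_topology_bigcup : forall F : set_system E,
    F `<=` O -> O (\bigcup_(A in F) A) }.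

Record topology_on (E : Type) := TopologyOn {
  opens :> set_system E;
  opens_topology : is_topology opens }.

Definition topologized (E : Type) (T : topology_on E) : Type := E.

Section topologized.
Variables (E : choiceType) (T : topology_on E).

HB.instance Definition _ := Choice.on (topologized T).

Let op_bigU (I : Type) (f : I -> set E) :
  (forall i, opens T (f i)) -> opens T (\bigcup_i f i).
Proof.
move=> fT; rewrite -(bigcup_image setT f id).
by apply: (is_topology_bigcup (opens_topology T)) => _ [i _ <-].
Qed.

HB.instance Definition _ := isOpenTopological.Build (topologized T)
  (is_topologyT (opens_topology T)) (is_topologyI (opens_topology T)) op_bigU.

End topologized.

HB.instance Definition _ (K : numDomainType) (E : lmodType K)
  (T : topology_on E) := GRing.Lmodule.on (topologized T).

Definition vector_topology (K : numFieldType) (E : lmodType K)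
    (T : topology_on E) : Prop :=
  continuous (fun x : topologized T * topologized T => x.1 + x.2) /\
  continuous (fun z : K^o * topologized T => z.1 *: z.2 : topologized T).

Definition locally_convex_topology (K : numFieldType) (E : lmodType K)
    (T : topology_on E) : Prop :=
  exists2 B : set_system (topologized T),
    (forall b, b \in B -> convex_set b) & basis B.

(* [inf_topology P] is the finest topology coarser than all those satisfying
   [P], and [sup_topology P] the coarsest one finer than all of them; they need
   not satisfy [P] in general, but see [weak_topologyP] and
   [inductive_limit_topologyP] for the two uses made of them. *)
Lemma bigcap_is_topology (E : Type) (P : set (topology_on E)) :
  is_topology (\bigcap_(T in P) opens T).
Proof.
split=> [T _ | A B PA PB T PT | F FP T PT].
- exact: is_topologyT (opens_topology T).
- by apply: (is_topologyI (opens_topology T)); [exact: PA | exact: PB].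
- by apply: (is_topology_bigcup (opens_topology T)) => A FA; apply: FP; exact.
Qed.

Definition inf_topology (E : Type) (P : set (topology_on E)) :
  topology_on E := TopologyOn (bigcap_is_topology P).

Lemma smallest_is_topology (E : Type) (S : set_system E) :
  is_topology (smallest (@is_topology E) S).
Proof.
split=> [Z [tO _] | A B SA SB Z [tO SO] | F FS Z [tO SO]].
- exact: is_topologyT tO.
- by apply: (is_topologyI tO); [exact: SA|exact: SB].
- by apply: (is_topology_bigcup tO) => A /FS; exact.
Qed.

Definition sup_topology (E : Type) (P : set (topology_on E)) :
  topology_on E :=
  TopologyOn (smallest_is_topology (\bigcup_(T in P) opens T)).

Section continuity_topologized.

Lemma topologized_open (E : choiceType) (T : topology_on E) :
  @open (topologized T) = opens T.
Proof. by []. Qed.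

Lemma preimage_is_topology (X : topologicalType) (E : Type) (f : X -> E) :
  is_topology [set A : set E | open (f @^-1` A)].
Proof.
split=> [ | A B | F FO] /=.
- by rewrite preimage_setT; exact: openT.
- by rewrite preimage_setI; exact: openI.
- by rewrite preimage_bigcup; apply: bigcup_open => A /FO.
Qed.

Lemma continuous_sup_topology (X : topologicalType) (E : choiceType)
    (P : set (topology_on E)) (f : X -> E) :
  (forall T, P T -> continuous (f : X -> topologized T)) ->
  continuous (f : X -> topologized (sup_topology P)).
Proof.
move=> fP; apply/continuousP => A; rewrite topologized_open /= => sA.
apply: (sA [set A : set E | open (f @^-1` A)]).
split; first exact: preimage_is_topology.
by move=> B [T PT TB]; move: (fP T PT) => /continuousP; exact.
Qed.

Lemma continuous_topologized_id (E : choiceType) (S T : topology_on E) :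
  opens T `<=` opens S -> continuous (id : topologized S -> topologized T).
Proof. by move=> TS; apply/continuousP => A; exact: TS. Qed.

Lemma sub_sup_topology (E : Type) (P : set (topology_on E)) (T : topology_on E) :
  P T -> opens T `<=` opens (sup_topology P).
Proof. by move=> PT A TA; apply: sub_gen_smallest; exists T. Qed.

Lemma sup_vector_topology (K : numFieldType) (E : lmodType K)
    (P : set (topology_on E)) :
  (forall T, P T -> vector_topology T) ->
  vector_topology (sup_topology P).
Proof.
move=> Pv; split.
  apply: (@continuous_sup_topology _ _ P) => T PT x; have [addT _] := Pv _ PT.
  have i := continuous_topologized_id (sub_sup_topology PT).
  pose pid (z : topologized (sup_topology P) *
                topologized (sup_topology P)) :
    topologized T * topologized T := (z.1, z.2).
  apply: (@continuous_comp _ _ (topologized T) pid (fun z => z.1 + z.2));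
    last exact: addT.
  apply: (@cvg_pair _ _ _ _ (nbhs (x.1 : topologized T))
    (nbhs (x.2 : topologized T))).
    exact: cvg_comp cvg_fst (i _).
  exact: cvg_comp cvg_snd (i _).
apply: (@continuous_sup_topology _ _ P) => T PT x; have [_ scaleT] := Pv _ PT.
have i := continuous_topologized_id (sub_sup_topology PT).
pose pid (z : K^o * topologized (sup_topology P)) :
  K^o * topologized T := (z.1, z.2).
apply: (@continuous_comp _ _ (topologized T) pid (fun z => z.1 *: z.2));
  last exact: scaleT.
apply: (@cvg_pair _ _ _ _ (nbhs x.1) (nbhs (x.2 : topologized T))).
  exact: cvg_fst.
exact: cvg_comp cvg_snd (i _).
Qed.

Lemma sup_locally_convex_topology (K : numFieldType) (E : lmodType K)
    (P : set (topology_on E)) :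
  (forall T, P T -> locally_convex_topology T) ->
  locally_convex_topology (sup_topology P).
Proof.
move=> Plc; set S := sup_topology P.
pose B : set_system (topologized S) := [set b | convex_set b /\ opens S b].
exists B; first by move=> b /set_mem[].
split; first by move=> b [].
move=> x A; rewrite nbhsE => -[U [SU Ux] UA].
pose Z : set_system E :=
  [set V | forall y, V y -> exists b : set (topologized S),
    [/\ convex_set b, opens S b, b y & b `<=` V]].
have tZ : is_topology Z.
  split=> [y _ | V V' ZV ZV' y [Vy V'y] | F FZ y [V FV Vy]].
  - exists setT; split=> //; exact: is_topologyT (opens_topology S).
  - have [b [cb Sb yb bV]] := ZV _ Vy; have [b' [cb' Sb' yb' bV']] := ZV' _ V'y.
    exists (b `&` b'); split=> //.
    + move=> u v l /set_mem[bu b'u] /set_mem[bv b'v]; apply/mem_set; split.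
        by apply/set_mem/cb; exact/mem_set.
      by apply/set_mem/cb'; exact/mem_set.
    + exact: (is_topologyI (opens_topology S)).
    + by apply: setISS.
  - have [b [cb Sb yb bV]] := FZ _ FV _ Vy.
    by exists b; split=> //; apply: subset_trans bV _ => z Vz; exists V.
have ZU : Z U.
  apply: SU; split=> // V [T PT TV] y Vy; have [D cD [Do Dn]] := Plc _ PT.
  have Vn : nbhs (y : topologized T) V by apply: open_nbhs_nbhs.
  have [b [Db yb] bV] := Dn y V Vn.
  exists b; split=> //; first by apply/cD/mem_set.
  exact: (sub_sup_topology PT) (Do _ Db).
have [b [cb Sb xb bU]] := ZU x Ux.
by exists b => //; exact: subset_trans UA.
Qed.

End continuity_topologized.

(** * Continuous duals *)

Section dual.
Variables (R : realType) (V : topologicalLmodType R[i]).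

Definition continuous_linear_pred : {pred V -> R[i]^o} :=
  fun f => `[< linear f /\ continuous f >].

Record dual := Dual {
  dual_fun :> V -> R[i]^o;
  dual_funP : dual_fun \in continuous_linear_pred }.

HB.instance Definition _ := [isSub for dual_fun].
HB.instance Definition _ := [Choice of dual by <:].

Let continuous_linear_pred_closed : submod_closed continuous_linear_pred.
Proof.
split=> [ | a f g /asboolP[lf cf] /asboolP[lg cg]]; apply/asboolP; split.
- by move=> a u v; rewrite /= scaler0 addr0.
- by move=> x; exact: cvg_cst.
- move=> b u v; change (a *: f (b *: u + v) + g (b *: u + v) =
    b *: (a *: f u + g u) + (a *: f v + g v)).
  by rewrite lf lg !scalerDr !scalerA [a * b]mulrC addrACA.
- move=> x; apply: (@cvgD R[i] R[i]^o V (nbhs x) _ (fun v => a *: f v) g).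
    exact: (cvg_comp _ _ (cf x) (@scaler_continuous _ R[i]^o a (f x))).
  exact: cg.
Qed.

HB.instance Definition _ := GRing.isSubmodClosed.Build _ _
  continuous_linear_pred continuous_linear_pred_closed.
HB.instance Definition _ := [SubChoice_isSubLmodule of dual by <:].

Lemma dual_linear (f : dual) : linear f.
Proof. by have /asboolP[] := dual_funP f. Qed.

Lemma dual_continuous (f : dual) : continuous f.
Proof. by have /asboolP[] := dual_funP f. Qed.

End dual.

Section dual_precomp.
Variables (R : realType) (V W : topologicalLmodType R[i]).
Variables (h : {linear V -> W}) (ch : continuous h).

Let precompP (f : dual W) :
  (f \o h : V -> R[i]^o) \in @continuous_linear_pred _ V.
Proof.
apply/asboolP; split; first by move=> a u v /=; rewrite linearP dual_linear.
by move=> x; apply: continuous_comp; [exact: ch | exact: dual_continuous].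
Qed.

Definition dual_precomp (f : dual W) : dual V := Dual (precompP f).

End dual_precomp.

(** * Weak topology *)

Definition weak_topology (R : realType) (V : topologicalLmodType R[i]) :
    topology_on (dual V) :=
  inf_topology [set T : topology_on (dual V) | vector_topology T /\
    forall v : V, continuous (fun f : topologized T => f v : R[i]^o)].

Section weak_topology_theory.
Variables (R : realType) (V : topologicalLmodType R[i]).

Let evaluation (v : V) (f : dual V) : R[i]^o := f v.

Let pullback_is_topology (v : V) :
  is_topology [set A | exists2 B, open B & A = evaluation v @^-1` B].
Proof.
split=> [ | A B [A' oA ->] [B' oB ->] | F FO].
- by exists setT; [exact: openT | rewrite preimage_setT].
- by exists (A' `&` B'); [exact: openI | rewrite preimage_setI].
- exists (\bigcup_(B in [set B | open B /\ F (evaluation v @^-1` B)]) B).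
    by apply: bigcup_open => B [].
  apply/seteqP; split=> f [A FA Af].
    have [B oB AB] := FO _ FA; exists B; last by rewrite AB in Af.
    by split=> //; rewrite -AB.
  by exists (evaluation v @^-1` A) => //; have [] := FA.
Qed.

Let pullback (v : V) := TopologyOn (pullback_is_topology v).

Let pullback_evaluation (v : V) :
  continuous (evaluation v : topologized (pullback v) -> R[i]^o).
Proof. by apply/continuousP => A oA; exists A. Qed.

Let pullback_continuous (X : topologicalType) (v : V) (g : X -> dual V) :
  continuous (evaluation v \o g) ->
  continuous (g : X -> topologized (pullback v)).
Proof. by move=> /continuousP cg; apply/continuousP => _ [B /cg oB ->]. Qed.

Let pullback_vector (v : V) : vector_topology (pullback v).
Proof.
have ev1 := @pullback_evaluation v.
split; apply: pullback_continuous => x.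
  apply: (@cvgD R[i] R[i]^o _ (nbhs x) _ (fun x => evaluation v x.1)
    (fun x => evaluation v x.2) (evaluation v x.1) (evaluation v x.2)).
    by apply: (@continuous_comp _ (topologized (pullback v)) R[i]^o fst
      (evaluation v)); [exact: cvg_fst | exact: ev1].
  by apply: (@continuous_comp _ (topologized (pullback v)) R[i]^o snd
      (evaluation v)); [exact: cvg_snd | exact: ev1].
apply: (@cvgZ R[i] R[i]^o _ (nbhs x) _ (fun x => x.1)
  (fun x => evaluation v x.2) x.1 (evaluation v x.2)).
  exact: cvg_fst.
by apply: (@continuous_comp _ (topologized (pullback v)) R[i]^o snd
    (evaluation v)); [exact: cvg_snd | exact: ev1].
Qed.

Let weak_topologyE : weak_topology V = sup_topology (range pullback).
Proof.
have E : opens (weak_topology V) = opens (sup_topology (range pullback)).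
  apply/seteqP; split.
    apply: bigcap_inf; split.
      by apply: sup_vector_topology => _ [v _ <-]; exact: pullback_vector.
    move=> v; apply/continuousP => A oA; apply: sub_sup_topology; first by exists v.
    by exists A.
  move=> A fA T [_ evT]; apply: fA; split; first exact: opens_topology.
  move=> _ [_ [v _ <-] [B oB ->]]; have /continuousP := evT v; exact.
case: (weak_topology V) (sup_topology _) E => [a ta] [b tb] /= ab.
by subst b; congr TopologyOn; exact: Prop_irrelevance.
Qed.

Lemma weak_topologyP : vector_topology (weak_topology V) /\
  forall v : V,
    continuous (fun f : topologized (weak_topology V) => f v : R[i]^o).
Proof.
rewrite weak_topologyE; split.
  by apply: sup_vector_topology => _ [v _ <-]; exact: pullback_vector.
move=> v; apply/continuousP => A oA; apply: sub_sup_topology; first by exists v.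
by exists A.
Qed.

Lemma weak_topology_coarsest (T : topology_on (dual V)) :
  vector_topology T ->
  (forall v : V, continuous (fun f : topologized T => f v : R[i]^o)) ->
  opens (weak_topology V) `<=` opens T.
Proof. by move=> vT evT; exact: bigcap_inf. Qed.

End weak_topology_theory.

(** * Strong topology *)

Definition tvs_bounded (K : numFieldType) (V : topologicalLmodType K)
    (D : set V) : Prop :=
  forall U, nbhs (0 : V) U -> exists2 l : K, 0 < l & D `<=` *:%R l @` U.

Lemma tvs_boundedU (K : numFieldType) (V : topologicalLmodType K)
    (D1 D2 : set V) :
  tvs_bounded D1 -> tvs_bounded D2 -> tvs_bounded (D1 `|` D2).
Proof.
move=> bD1 bD2 U U0.
have := @scale_continuous K V (0, 0) U; rewrite /= scaler0.
move=> /(_ U0)[[A B] /= [/nbhs_ballP[d /= d0 dA] B0] ABU].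
have [l1 l10 D1l] := bD1 _ B0; have [l2 l20 D2l] := bD2 _ B0.
have d20 : 0 < d / 2 by rewrite divr_gt0.
have l12 : 0 < l1 + l2 by rewrite addr_gt0.
pose l := (l1 + l2) / (d / 2).
have l0 : 0 < l by rewrite divr_gt0.
have key k b : 0 < k -> k <= l1 + l2 -> B b -> ( *:%R l @` U) (k *: b).
  move=> k0 kl Bb; exists ((k / l) *: b); last first.
    by rewrite scalerA mulrCA divff ?mulr1 // gt_eqF.
  apply: (ABU (k / l, b)); split=> //=; apply: dA.
  rewrite -ball_normE /= sub0r normrN gtr0_norm ?divr_gt0 //.
  rewrite /l invf_div mulrCA (@le_lt_trans _ _ (d / 2)) //.
    by apply: ler_piMr; [exact: ltW | rewrite ler_pdivrMr // mul1r].
  by rewrite ltr_pdivrMr // ltr_pMr // ltr1n.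
exists l => // x [/D1l | /D2l] [b Bb <-]; apply: key => //.
  by rewrite lerDl ltW.
by rewrite lerDr ltW.
Qed.

Section strong_topology.
Variables (R : realType) (V : topologicalLmodType R[i]).

Definition strong_nbhs0 (D : set V) (e : R) : set (dual V) :=
  [set f | (ereal_sup [set (normc (f v))%:E | v in D] < e%:E)%E].

Definition strong_open : set_system (dual V) :=
  [set U | forall f, U f -> exists D e,
    [/\ tvs_bounded D, 0 < e & forall g, strong_nbhs0 D e (g - f) -> U g]].

Lemma strong_open_is_topology : is_topology strong_open.
Proof.
split=> [f _ | A B oA oB f [Af Bf] | F oF f [A FA Af]].
- exists set0, 1; split=> // U _; exists 1; first exact: ltr01.
  exact: sub0set.
- have [D1 [e1 [bD1 e10 AD1]]] := oA _ Af.
  have [D2 [e2 [bD2 e20 BD2]]] := oB _ Bf.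
  exists (D1 `|` D2), (Order.min e1 e2); split; first exact: tvs_boundedU.
    by rewrite lt_min e10.
  move=> g; rewrite /strong_nbhs0 /= => gD; split.
    apply: AD1; rewrite /strong_nbhs0 /=.
    apply: (le_lt_trans _ (lt_le_trans gD _)).
      by apply: ereal_sup_le => _ [v D1v <-]; exists v => //; left.
    by rewrite lee_fin ge_min lexx.
  apply: BD2; rewrite /strong_nbhs0 /=.
  apply: (le_lt_trans _ (lt_le_trans gD _)).
    by apply: ereal_sup_le => _ [v D2v <-]; exists v => //; right.
  by rewrite lee_fin ge_min lexx orbT.
- have [D [e [bD e0 DA]]] := oF _ FA _ Af.
  by exists D, e; split=> // g /DA Ag; exists A.
Qed.

Definition strong_topology : topology_on (dual V) :=
  TopologyOn strong_open_is_topology.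

End strong_topology.

(** * Countably-Hilbert spaces *)

Section countably_Hilbert.
Variables (R : realType) (V : topologicalLmodType R[i]).

Record is_norm (q : V -> R) : Prop := {
  is_normD : forall u v, q (u + v) <= q u + q v;
  is_normZ : forall (a : R[i]) v, q (a *: v) = normc a * q v;
  is_norm_eq0 : forall v, q v = 0 -> v = 0 }.

Definition inner_product_norm (q : V -> R) : Prop :=
  exists ip : {dot V for Num.conj}, forall v, ((q v) ^+ 2)%:C = ip v v.

Definition generated_by_norms (p : nat -> V -> R) : Prop :=
  forall (x : V) (U : set V), nbhs x U <->
    exists (s : seq nat) (e : R), 0 < e /\
      forall y, (forall n, n \in s -> p n (y - x) < e) -> U y.

Record countably_normed (p : nat -> V -> R) : Prop := {
  countably_normed_norm : forall n, is_norm (p n);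
  countably_normed_topology : generated_by_norms p }.

(* [V] carries no [uniformType] structure: Cauchy filters refer to the
   canonical uniformity of the underlying additive topological group. *)
Definition tvs_cauchy (F : set_system V) : Prop :=
  forall U, nbhs (0 : V) U ->
    exists2 A, F A & forall x y, A x -> A y -> U (x - y).

Definition tvs_complete : Prop :=
  forall F : set_system V, ProperFilter F -> tvs_cauchy F ->
    exists x : V, F --> x.

Record countably_Hilbert (p : nat -> V -> R) : Prop := {
  countably_Hilbert_normed : countably_normed p;
  countably_Hilbert_inner : forall n, inner_product_norm (p n);
  countably_Hilbert_complete : tvs_complete }.

End countably_Hilbert.

(** * Completions for the individual norms, and the inductive limit topology *)

Record completion (R : realType) (V : topologicalLmodType R[i])
    (q : V -> R) := Completion {
  completion_space :> completeNormedModType R[i];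
  completion_map : {linear V -> completion_space};
  completion_isometry : forall v, `|completion_map v| = (q v)%:C;
  completion_dense : dense (range completion_map) }.

Section inductive_limit.
Variables (R : realType) (V : topologicalLmodType R[i]) (p : nat -> V -> R).

Definition dual_norm (W : normedModType R[i]) (f : dual W) : \bar R :=
  ereal_sup [set (normc (f w))%:E | w in [set w : W | `|w| <= 1]].

Definition dual_norm_open (W : normedModType R[i]) : set_system (dual W) :=
  [set U | forall f, U f -> exists2 e : R, 0 < e &
    forall g, (dual_norm (g - f)%R < e%:E)%E -> U g].

Lemma dual_norm_open_is_topology (W : normedModType R[i]) :
  is_topology (@dual_norm_open W).
Proof.
split=> [f _ | A B oA oB f [Af Bf] | F oF f [A FA Af]]; first by exists 1.
- have [e1 e10 Ae1] := oA _ Af; have [e2 e20 Be2] := oB _ Bf.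
  exists (Order.min e1 e2); first by rewrite lt_min e10.
  move=> g ge; split.
    apply: Ae1; apply: (lt_le_trans ge).
    by rewrite lee_fin ge_min lexx.
  apply: Be2; apply: (lt_le_trans ge).
  by rewrite lee_fin ge_min lexx orbT.
- have [e e0 eA] := oF _ FA _ Af.
  by exists e => // g /eA Ag; exists A.
Qed.

Definition dual_norm_topology (W : normedModType R[i]) :
  topology_on (dual W) := TopologyOn (@dual_norm_open_is_topology W).

Variable pV : countably_normed p.

Lemma completion_map_continuous n (W : completion (p n)) :
  continuous (completion_map W).
Proof.
move=> x; apply/cvgrPdist_lt => -[e e'] e0.
have /andP[/eqP /= e'0 Ree] : (e' == 0) && (0 < e) by move: e0; rewrite ltcE.
rewrite e'0; apply/(countably_normed_topology pV).
exists [:: n], e; split=> // y /(_ n (mem_head _ _)) pye /=.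
by rewrite distrC -linearB completion_isometry ltcR.
Qed.

Definition dual_inclusion n (W : completion (p n)) : dual W -> dual V :=
  dual_precomp (@completion_map_continuous n W).

Definition inductive_limit_topology (W : forall n, completion (p n)) :
    topology_on (dual V) :=
  sup_topology [set T : topology_on (dual V) |
    [/\ vector_topology T, locally_convex_topology T &
        forall n, continuous (@dual_inclusion n (W n) :
          topologized (dual_norm_topology (W n)) -> topologized T)]].

End inductive_limit.

Section inductive_limit_theory.
Variables (R : realType) (V : topologicalLmodType R[i]) (p : nat -> V -> R).
Variables (pV : countably_normed p) (W : forall n, completion (p n)).

Lemma inductive_limit_topologyP :
  [/\ vector_topology (inductive_limit_topology pV W),
      locally_convex_topology (inductive_limit_topology pV W) &
      forall n, continuous (@dual_inclusion _ _ _ pV n (W n) :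
        topologized (dual_norm_topology (W n)) ->
        topologized (inductive_limit_topology pV W))].
Proof.
split.
- by apply: sup_vector_topology => T [].
- by apply: sup_locally_convex_topology => T [].
- by move=> n; apply: continuous_sup_topology => T [_ _]; exact.
Qed.

Lemma inductive_limit_topology_finest (T : topology_on (dual V)) :
  vector_topology T -> locally_convex_topology T ->
  (forall n, continuous (@dual_inclusion _ _ _ pV n (W n) :
    topologized (dual_norm_topology (W n)) -> topologized T)) ->
  opens T `<=` opens (inductive_limit_topology pV W).
Proof. by move=> vT cT iT; exact: sub_sup_topology. Qed.

End inductive_limit_theory.

(* Main.v *)
(* Let a topology on V' make every inclusion V_n' -> V' continuous; the strong
   and the inductive limit topologies do.  If U is open for it, then
   U = \bigcup_n (U `&` V_n'), and each U `&` V_n' is open in the norm of V_n'.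
   Since V is separable and V_n is a Hilbert space, the functionals ip_n _ d,
   with d in a countable dense subset of V, are dense in V_n'; so U `&` V_n' is
   a countable union of balls {f | |f v - ip_n v d| <= r p_n v for all v}.  Such a
   ball is an intersection of weakly closed sets, hence U is weakly measurable.
   Conversely the weak topology is coarser than the two others. *)
Require Import Defs.
From mathcomp Require Import all_boot all_order all_algebra.
From mathcomp Require Import sesquilinear complex.
From mathcomp Require Import all_classical all_reals all_analysis.
From mathcomp Require Import ring lra.

Import Order.TTheory GRing.Theory Num.Theory.
Import numFieldNormedType.Exports.

Local Notation normc := Normc.normc.

Local Open Scope classical_set_scope.
Local Open Scope ring_scope.

(** * Complex modulus and the Cauchy-Schwarz inequality *)

Lemma normrE_normc (R : rcfType) (z : R[i]) : `|z| = (normc z)%:C%C.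
Proof. by []. Qed.

Lemma normc_ge0 (R : rcfType) (z : R[i]) : 0 <= normc z.
Proof. by case: z => a b; exact: sqrtr_ge0. Qed.

Lemma ler_Re_normc (R : rcfType) (z : R[i]) : `|complex.Re z| <= normc z.
Proof. by have := normc_ge_Re z; rewrite normrE_normc lecR. Qed.

Lemma ler_Im_normc (R : rcfType) (z : R[i]) : `|complex.Im z| <= normc z.
Proof.
rewrite -normrN -ReiNIm (le_trans (ler_Re_normc _ _)) // Normc.normcM.
by rewrite [X in _ * X]/= expr0n expr1n add0r sqrtr1 mulr1.
Qed.

Lemma normc_le_Re_Im (R : rcfType) (z : R[i]) :
  normc z <= `|complex.Re z| + `|complex.Im z|.
Proof.
case: z => a b; rewrite -(@ler_pXn2r _ 2) // ?nnegrE ?addr_ge0 ?sqrtr_ge0 //=.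
rewrite sqr_sqrtr ?addr_ge0 ?sqr_ge0 // sqrrD !real_normK ?num_real //.
by rewrite lerD2r lerDl mulrn_wge0 ?mulr_ge0.
Qed.

(** The form at [u - k b v], with [k] real and [b = B u v], is a real quadratic in [k];
    [k = 1 / B v v] gives the bound. The case [B v v = 0] stands apart, since the form may
    degenerate, as the one built from a functional below can. *)
Lemma semidefinite_CauchySchwarz (C : numClosedFieldType) (V : lmodType C)
    (B : V -> V -> C) :
  (forall (a : C) u v w, B (a *: u + v) w = a * B u w + B v w) ->
  (forall u v, B u v = (B v u)^*) ->
  (forall u, 0 <= B u u) ->
  forall u v, `|B u v| ^+ 2 <= B u u * B v v.
Proof.
move=> Blin Bherm Bpos u v.
have Blinr a x y z : B x (a *: y + z) = a^* * B x y + B x z.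
  by rewrite Bherm Blin rmorphD rmorphM /= -!Bherm.
set b := B u v; set q := B v v; set s := B u u.
have qge0 : 0 <= q by exact: Bpos.
have sge0 : 0 <= s by exact: Bpos.
have bb : b * b^* = `|b| ^+ 2 by rewrite normCK.
have quad k : k \is Num.real ->
    0 <= k ^+ 2 * (`|b| ^+ 2 * q) - k * `|b| ^+ 2 *+ 2 + s.
  move=> kreal; have := Bpos (- (k * b) *: v + u).
  rewrite Blin !Blinr -/q -/s -/b [B v u]Bherm -/b rmorphN rmorphM /=.
  rewrite conj_Creal // -bb.
  by congr (0 <= _); ring.
have [q0|qn0] := eqVneq q 0.
  rewrite q0 mulr0; have [->|bn0] := eqVneq b 0; first by rewrite normr0 expr0n.
  have b2 : 0 < `|b| ^+ 2 by rewrite exprn_gt0 // normr_gt0.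
  (* With [q = 0] the inequality is affine in [k]; this value turns it into [0 <= - (s + 2)]. *)
  have kreal : (s + 1) / `|b| ^+ 2 \is Num.real.
    by rewrite realM ?realV ?gtr0_real // ltr_wpDl.
  have := quad _ kreal; rewrite q0 !mulr0 sub0r divfK ?gt_eqF //.
  have -> : - ((s + 1) *+ 2) + s = - (s + 2) by ring.
  rewrite oppr_ge0 => s2; have s2gt0 : 0 < s + 2 by rewrite ltr_wpDl.
  by have := lt_le_trans s2gt0 s2; rewrite ltxx.
have qgt0 : 0 < q by rewrite lt_def qn0.
have := quad q^-1; rewrite realV gtr0_real // => /(_ isT).
have -> : q^-1 ^+ 2 * (`|b| ^+ 2 * q) - q^-1 * `|b| ^+ 2 *+ 2 + s =
  (s * q - `|b| ^+ 2) / q by field.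
by rewrite pmulr_lge0 ?invr_gt0 // subr_ge0.
Qed.

(** * Approximation of bounded functionals by inner products *)

Section pre_Hilbert.
Variables (R : realType) (V : lmodType R[i]).
Variables (ip : {dot V for @Num.conj R[i]}) (q : V -> R).
Hypothesis q_ge0 : forall v, 0 <= q v.
Hypothesis ip_q : forall v, ((q v) ^+ 2)%:C%C = ip v v.

Let ip_lin (a : R[i]) u v w : ip (a *: u + v) w = a * ip u w + ip v w.
Proof. exact: linearPl. Qed.

Let ip_linr (a : R[i]) u v w : ip w (a *: u + v) = a^* * ip w u + ip w v.
Proof. exact: linearPr. Qed.

Let ipC u v : ip u v = (ip v u)^*.
Proof. by rewrite (hermC ip) expr0 mul1r. Qed.

Lemma inner_CauchySchwarz u v : normc (ip u v) <= q u * q v.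
Proof.
have := semidefinite_CauchySchwarz _ V ip ip_lin ipC (dnorm_ge0 ip) u v.
rewrite -!ip_q -rmorphM normrE_normc -rmorphXn /= lecR.
by rewrite -exprMn ler_pXn2r // nnegrE ?mulr_ge0 // normc_ge0.
Qed.

(* With [M] the norm of [f] and [x] nearly norming it, the Cauchy-Schwarz
   inequality for the semidefinite form [M ^ 2 ip u v - f u (f v)^*] shows that
   [f] is close to [M ^ 2 ip _ x / (f x)^*]; this avoids the Riesz
   representation theorem, hence the completion. *)
Lemma dense_inner_functionals (f : V -> R[i]) (C : R) :
  (forall (a : R[i]) u v, f (a *: u + v) = a * f u + f v) ->
  (forall v, normc (f v) <= C * q v) ->
  forall e : R, 0 < e ->
    exists u, forall v, normc (f v - ip v u) <= e * q v.
Proof.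
move=> flin fC e e0.
(* Where [q v = 0] the quotient is 0 by convention, in accordance with [f v = 0], which [fC] forces
   there. *)
pose A := [set normc (f v) / q v | v in setT].
have Asup : has_sup A.
  split; first by exists (normc (f 0) / q 0), 0.
  exists (Order.max C 0) => _ [v _ <-].
  have [->|qv] := eqVneq (q v) 0; first by rewrite invr0 mulr0 le_max lexx orbT.
  rewrite ler_pdivrMr; last by rewrite lt_def qv q_ge0.
  by apply: (le_trans (fC v)); rewrite ler_wpM2r // le_max lexx.
pose M := sup A.
have fM v : normc (f v) <= M * q v.
  have [qv|qv] := eqVneq (q v) 0; first by rewrite qv mulr0 -(mulr0 C) -qv.
  rewrite -ler_pdivrMr; last by rewrite lt_def qv q_ge0.
  by apply: sup_upper_bound => //; exists v.
have M0 : 0 <= M.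
  apply: (@le_trans _ _ (normc (f 0) / q 0)); first by rewrite divr_ge0 // normc_ge0.
  by apply: sup_upper_bound => //; exists 0.
have [M0'|Mn0] := eqVneq M 0.
  exists 0 => v; rewrite linear0r subr0 (le_trans (fM v)) // M0' mul0r.
  by rewrite mulr_ge0 // ltW.
have Mgt0 : 0 < M by rewrite lt_def Mn0.
(* The bound [M / 2] keeps [f x] away from 0 and gives [M q x <= 2 N]; the bound [e ^ 2 / (8 M)]
   absorbs the factor [2 M d * 4] of the final estimate. *)
pose d := Order.min (M / 2) (e ^+ 2 / (8 * M)).
have d0 : 0 < d by rewrite lt_min !divr_gt0 ?exprn_gt0 ?mulr_gt0.
have [_ [x _ <-] Mx] := sup_adherent d0 Asup.
rewrite -/M in Mx.
have dM : d <= M / 2 by rewrite ge_min lexx.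
have de : 8 * M * d <= e ^+ 2.
  by rewrite mulrC -ler_pdivlMr ?mulr_gt0 // ge_min lexx orbT.
have qx : 0 < q x.
  rewrite lt_def q_ge0 andbT; apply/eqP => qx0; move: Mx.
  rewrite qx0 invr0 mulr0; lra.
move: Mx; rewrite ltr_pdivlMr // => Mx.
pose N := normc (f x).
have N0 : 0 < N by apply: le_lt_trans Mx; rewrite mulr_ge0 //; lra.
have fx0 : f x != 0.
  by apply/eqP => fx0; move: N0; rewrite /N fx0 Normc.normc0 ltxx.
pose B u v := (M ^+ 2)%:C%C * ip u v - f u * (f v)^*.
have Blin (a : R[i]) u v w : B (a *: u + v) w = a * B u w + B v w.
  by rewrite /B ip_lin flin; ring.
have Bherm u v : B u v = (B v u)^*.
  rewrite /B rmorphB !rmorphM /= conjCK -ipC [f u * _]mulrC; congr (_ * _ - _).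
  by rewrite conj_Creal // complex_real.
have BE u : B u u = (M ^+ 2 * q u ^+ 2 - normc (f u) ^+ 2)%:C%C.
  rewrite /B -ip_q -normCK normrE_normc.
  by rewrite -[X in _ - X]rmorphXn -rmorphM -rmorphB.
have Bpos u : 0 <= B u u.
  rewrite BE lecR subr_ge0 -exprMn ler_pXn2r ?nnegrE ?mulr_ge0 //.
  exact: normc_ge0.
(* As [ip] is conjugate-linear on the right, the error is exactly [- B v x / (f x)^*]. *)
exists (((M ^+ 2)%:C%C / f x) *: x) => v.
have -> : f v - ip v (((M ^+ 2)%:C%C / f x) *: x) = - (B v x / (f x)^*).
  have -> : ip v (((M ^+ 2)%:C%C / f x) *: x) = ((M ^+ 2)%:C%C / f x)^* * ip v x.
    by rewrite -[_ *: x]addr0 ip_linr linear0r addr0.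
  rewrite rmorphM fmorphV /=.
  have -> : ((M ^+ 2)%:C%C : R[i])^* = (M ^+ 2)%:C%C by rewrite conj_Creal // complex_real.
  by rewrite /B; field; rewrite conjC_eq0.
rewrite normcN Normc.normcM Normc.normcV.
have -> : normc (f x)^* = N.
  by apply: complexI; rewrite -!normrE_normc norm_conjC.
rewrite ler_pdivrMr //.
have := semidefinite_CauchySchwarz _ V B Blin Bherm Bpos v x.
rewrite !BE -rmorphM normrE_normc -rmorphXn /= lecR -/N => BN.
rewrite -(@ler_pXn2r _ 2) // ?nnegrE ?mulr_ge0 ?normc_ge0 //; try exact: ltW.
apply: (le_trans BN).
have h1 : M ^+ 2 * q v ^+ 2 - normc (f v) ^+ 2 <= M ^+ 2 * q v ^+ 2.
  by rewrite gerBl sqr_ge0.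
have NM : ((M - d) * q x) ^+ 2 <= N ^+ 2.
  by rewrite ler_pXn2r ?nnegrE ?mulr_ge0 ?(ltW Mx) ?(ltW N0) //; lra.
(* This bounds [B x x]: it is of order [d] because [x] nearly norms [f]. *)
have h2 : M ^+ 2 * q x ^+ 2 - N ^+ 2 <= 2 * M * d * q x ^+ 2.
  apply: (@le_trans _ _ (M ^+ 2 * q x ^+ 2 - ((M - d) * q x) ^+ 2)).
    by rewrite lerD2l lerN2.
  have -> : M ^+ 2 * q x ^+ 2 - ((M - d) * q x) ^+ 2 =
    2 * M * d * q x ^+ 2 - d ^+ 2 * q x ^+ 2 by ring.
  by rewrite gerBl mulr_ge0 ?sqr_ge0.
have h3 : (M * q x) ^+ 2 <= 4 * N ^+ 2.
  have : (M * q x / 2) ^+ 2 <= N ^+ 2.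
    rewrite ler_pXn2r ?nnegrE ?divr_ge0 ?mulr_ge0 //; try exact: ltW.
    apply: ltW; apply: le_lt_trans Mx; rewrite mulrAC ler_pM2r //; lra.
  by rewrite expr_div_n; lra.
apply: (@le_trans _ _ (M ^+ 2 * q v ^+ 2 * (2 * M * d * q x ^+ 2))).
  apply: (@le_trans _ _ (M ^+ 2 * q v ^+ 2 * (M ^+ 2 * q x ^+ 2 - N ^+ 2))).
    by rewrite ler_wpM2r //; have := Bpos x; rewrite BE lecR.
  by rewrite ler_wpM2l // mulr_ge0 ?sqr_ge0.
have -> : M ^+ 2 * q v ^+ 2 * (2 * M * d * q x ^+ 2) =
  q v ^+ 2 * (2 * M * d) * (M * q x) ^+ 2 by ring.
apply: (@le_trans _ _ (q v ^+ 2 * (2 * M * d) * (4 * N ^+ 2))).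
  by rewrite ler_wpM2l // !mulr_ge0 ?sqr_ge0 // ltW.
have -> : q v ^+ 2 * (2 * M * d) * (4 * N ^+ 2) = 8 * M * d * (q v ^+ 2 * N ^+ 2) by ring.
by rewrite !exprMn -[e ^+ 2 * _ * _]mulrA ler_wpM2r // mulr_ge0 ?sqr_ge0.
Qed.

End pre_Hilbert.

(** * Extension of functionals to a completion *)

Lemma normv_Re (R : rcfType) (W : normedZmodType R[i]) (w : W) :
  (complex.Re `|w|)%:C%C = `|w|.
Proof. by rewrite RRe_real // normr_real. Qed.

Lemma Re_normv_ge0 (R : rcfType) (W : normedZmodType R[i]) (w : W) :
  0 <= complex.Re `|w|.
Proof. by rewrite -ler0c normv_Re. Qed.

(* The value of the extension at [w] is pinned down by the inequalities
   [`|z - f v| <= 2 c `|w - v|]; its real and imaginary parts are suprema of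
   [Re (f v) - c `|w - v|] and [Im (f v) - c `|w - v|], hence the factor 2. *)
Lemma completion_extension (R : realType) (V : topologicalLmodType R[i])
    (q : V -> R) (W : completion q) (f : V -> R[i]) (c : R) :
  (forall (a : R[i]) u v, f (a *: u + v) = a * f u + f v) ->
  0 <= c -> (forall v, normc (f v) <= c * q v) ->
  exists g : dual W, (forall v, g (completion_map W v) = f v) /\
    forall w, normc (g w) <= 2 * c * complex.Re `|w|.
Proof.
move=> flin c0 fc; pose phi := completion_map W.
have phiq v : complex.Re `|phi v| = q v by rewrite completion_isometry.
have fB u v : f u - f v = f (u - v).
  by rewrite [u - v]addrC -[- v]scaleN1r flin mulN1r addrC.
have fphi u v : normc (f u - f v) <= c * complex.Re `|phi u - phi v|.
  by rewrite fB -linearB phiq.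
have tri (a b d : W) : complex.Re `|a - b| <= complex.Re `|d - a| + complex.Re `|d - b|.
  rewrite -lecR rmorphD /= !normv_Re; apply: (le_trans (ler_distD d a b)).
  by rewrite distrC.
have partial (h : R[i] -> R) : (forall x y, h x - h y <= normc (x - y)) ->
    forall w, exists a, forall v, `|a - h (f v)| <= c * complex.Re `|w - phi v|.
  move=> hn w; pose A := [set h (f v) - c * complex.Re `|w - phi v| | v in setT].
  (* McShane's extension of a Lipschitz real function, with [h] the real or imaginary part: the
     upper bounds come from the triangle inequality through [w]. *)
  have Aub v : ubound A (h (f v) + c * complex.Re `|w - phi v|).
    move=> _ [u _ <-]; rewrite lerBlDr -addrA -lerBlDl.
    apply: (le_trans (hn _ _)); apply: (le_trans (fphi _ _)).
    by rewrite -mulrDr ler_wpM2l // [leRHS]addrC; exact: tri.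
  have A0 : A !=set0 by exists (h (f 0) - c * complex.Re `|w - phi 0|), 0.
  exists (sup A) => v; rewrite ler_distl; apply/andP; split.
    apply: sup_upper_bound; last by exists v.
    by split=> //; exists (h (f v) + c * complex.Re `|w - phi v|).
  exact: sup_le_ub.
have ex w : exists z : R[i], forall v, normc (z - f v) <= 2 * c * complex.Re `|w - phi v|.
  have ReB (x y : R[i]) : complex.Re x - complex.Re y <= normc (x - y).
    have -> : complex.Re x - complex.Re y = complex.Re (x - y) by case: x y => ? ? [].
    exact: le_trans (ler_norm _) (ler_Re_normc _ _).
  have ImB (x y : R[i]) : complex.Im x - complex.Im y <= normc (x - y).
    have -> : complex.Im x - complex.Im y = complex.Im (x - y) by case: x y => ? ? [].
    exact: le_trans (ler_norm _) (ler_Im_normc _ _).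
  have [a ha] := partial _ ReB w; have [b hb] := partial _ ImB w.
  exists (a +i* b)%C => v; apply: (le_trans (normc_le_Re_Im _ _)).
  rewrite -mulrA mulr_natl mulr2n; apply: lerD.
    by move: (ha v); case: (f v).
  by move: (hb v); case: (f v).
pose g w : R[i]^o := projT1 (cid (ex w)).
have gP w v : normc (g w - f v) <= 2 * c * complex.Re `|w - phi v|.
  by rewrite /g; case: cid.
have c20 : 0 <= 2 * c by rewrite mulr_ge0.
have gphi v : g (phi v) = f v.
  apply/eqP; rewrite -subr_eq0; apply/eqP/Normc.eq0_normc/eqP.
  rewrite eq_le normc_ge0 andbT.
  by apply: (le_trans (gP _ v)); rewrite subrr normr0 mulr0.
have f0 : f 0 = 0 by have := fB 0 0; rewrite !subrr.
have gbound w : normc (g w) <= 2 * c * complex.Re `|w|.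
  by have := gP w 0; rewrite f0 subr0 /phi linear0 subr0.
have near w (r : R) : 0 < r -> exists v, complex.Re `|w - phi v| < r.
  move=> r0; have rC0 : 0 < r%:C%C :> R[i] by rewrite ltcR.
  have [] := @completion_dense _ _ _ W (ball w r%:C%C)^°.
  - by exists w; exact: nbhsx_ballx.
  - exact: open_interior.
  move=> x [wv [v _ vE]]; move: wv; rewrite -vE.
  move=> /interior_subset; rewrite -ball_normE /= => wv.
  by exists v; rewrite -ltcR normv_Re.
(* The values of [g] are chosen point by point, so linearity is recovered from that of [f] by
   approximating [u] and [v] from [V]. *)
have glin : linear g.
  move=> a u v; apply/eqP; rewrite -subr_eq0; apply/eqP/Normc.eq0_normc/eqP.
  rewrite eq_le normc_ge0 andbT; apply/ler_addgt0Pr => e e0; rewrite add0r.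
  (* One term [2 c (|a| + 1)] pays for the error at [a u + v], the other for those at [u] and [v];
     the 1 makes [K] positive. *)
  pose K := 2 * c * (normc a + 1) *+ 2 + 1.
  have K0 : 0 < K by rewrite ltr_wpDl // mulrn_wge0 // mulr_ge0 // addr_ge0 // normc_ge0.
  have r0 : 0 < e / K by rewrite divr_gt0.
  have [u' hu] := near u _ r0; have [v' hv] := near v _ r0.
  have -> : g (a *: u + v) - (a *: g u + g v) =
    (g (a *: u + v) - f (a *: u' + v')) - (a * (g u - f u') + (g v - f v')).
    by rewrite flin -[a *: g u]/(a * g u); ring.
  have n1 : complex.Re `|a *: u + v - phi (a *: u' + v')| <=
      (normc a + 1) * (e / K).
    have -> : a *: u + v - phi (a *: u' + v') = a *: (u - phi u') + (v - phi v').
      by rewrite linearP scalerBr opprD addrACA.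
    rewrite -lecR normv_Re; apply: (le_trans (ler_normD _ _)).
    rewrite normrZ -(normv_Re _ _ (u - _)) -(normv_Re _ _ (v - _)).
    rewrite normrE_normc -rmorphM -rmorphD lecR mulrDl mul1r.
    by rewrite lerD ?ler_wpM2l ?normc_ge0 // ltW.
  apply: (le_trans (le_normcD _ _)); rewrite normcN.
  apply: (@le_trans _ _ (K * (e / K))); last by rewrite mulrCA divff ?mulr1 ?gt_eqF.
  rewrite /K mulrDl mul1r -[leLHS]addr0; apply: lerD; last exact: ltW.
  rewrite mulrnAl mulr2n; apply: lerD.
    by rewrite -mulrA; apply: (le_trans (gP _ _)); rewrite ler_wpM2l.
  apply: (le_trans (le_normcD _ _)); rewrite Normc.normcM -[leRHS]mulrA.
  rewrite [(normc a + 1) * _]mulrDl mul1r mulrDr; apply: lerD.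
    rewrite mulrCA ler_wpM2l ?normc_ge0 //; apply: (le_trans (gP _ _)).
    by rewrite ler_wpM2l // ltW.
  by apply: (le_trans (gP _ _)); rewrite ler_wpM2l // ltW.
have gcont : continuous g.
  (* Radii are elements of [R[i]]; positivity makes the imaginary part [e'] vanish. *)
  move=> w; apply/cvgrPdist_lt => -[e e'] e0.
  have /andP[/eqP /= e'0 Ree] : (e' == 0) && (0 < e) by move: e0; rewrite ltcE.
  rewrite {}e'0 in e0 *.
  have K0 : 0 < 2 * c + 1 by rewrite ltr_wpDl.
  have rC0 : 0 < (e / (2 * c + 1))%:C%C :> R[i] by rewrite ltcR divr_gt0.
  apply: filterS (nbhsx_ballx w _ rC0) => y.
  rewrite -ball_normE /= -(normv_Re _ _ (w - y)) ltcR => wy.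
  have -> : g w - g y = g (w - y).
    by rewrite [w - y]addrC -[- y]scaleN1r glin scaleN1r addrC.
  rewrite ltcR; apply: (le_lt_trans (gbound _)).
  move: wy; rewrite ltr_pdivlMr // => wy; apply: le_lt_trans wy.
  by rewrite [leRHS]mulrC ler_wpM2r ?lerDl // Re_normv_ge0.
have gP' : (g : W -> R[i]^o) \in @continuous_linear_pred R W by exact/asboolP.
by exists (Dual gP').
Qed.

(** * Bounds for functionals, and weakly closed balls *)

Lemma is_norm_ge0 (R : realType) (V : topologicalLmodType R[i]) (q : V -> R) :
  is_norm q -> forall v, 0 <= q v.
Proof.
move=> qn v; have q0 : q 0 = 0 by rewrite -(scale0r v) (is_normZ qn) Normc.normc0 mul0r.
have := is_normD qn v (- v); rewrite subrr q0 -scaleN1r (is_normZ qn) normcN.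
by rewrite Normc.normc1 mul1r -mulr2n pmulrn_lge0.
Qed.

Lemma dual0 (R : realType) (V : topologicalLmodType R[i]) (f : dual V) : f 0 = 0.
Proof.
by have := dual_linear f (-1) 0 0; rewrite scaler0 addr0 scaleN1r addNr.
Qed.

(** This is the equality of [V'] with the union of the [V_n']: continuity at 0 involves finitely
    many norms, which the one of largest index dominates, and homogeneity does the rest. *)
Lemma dual_bounded (R : realType) (V : topologicalLmodType R[i])
    (p : nat -> V -> R) (f : dual V) :
  countably_normed p -> (forall n v, p n v <= p n.+1 v) ->
  exists n (c : R), 0 <= c /\ forall v, normc (f v) <= c * p n v.
Proof.
move=> pV p_incr; have f0 := dual0 _ _ f.
have /cvgrPdist_lt /(_ 1 ltr01) := @dual_continuous _ _ f 0.
move=> /(countably_normed_topology pV)[s [e [e0 se]]].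
have p_le v m n : (m <= n)%N -> p m v <= p n v.
  by move=> /subnK <-; elim: (n - m)%N => // k /le_trans; apply; exact: p_incr.
pose N := \max_(i <- s) i; exists N, (2 / e); split; first by rewrite divr_ge0 // ltW.
move=> v; have pn := countably_normed_norm pV N.
have [pv0|pvn0] := eqVneq (p N v) 0.
  by rewrite (is_norm_eq0 pn pv0) f0 Normc.normc0 mulr_ge0 ?is_norm_ge0 // divr_ge0 // ltW.
have pv : 0 < p N v by rewrite lt_def pvn0 is_norm_ge0.
(* Scaling by [k] brings [v] to norm [e / 2], where [f] has modulus below 1; [1 / k] is then the
   claimed bound. *)
pose k := e / (2 * p N v); have k0 : 0 < k by rewrite divr_gt0 // mulr_gt0.
have kC : normc k%:C%C = k by apply: complexI; rewrite -normrE_normc ger0_norm // ler0c ltW.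
have /se : forall n, n \in s -> p n (k%:C%C *: v - 0) < e.
  move=> n ns; rewrite subr0 (le_lt_trans (p_le _ _ N _)) //.
    by rewrite /N; exact: leq_bigmax_seq.
  rewrite (is_normZ pn) kC.
  have -> : k * p N v = e / 2 by rewrite /k; field; rewrite pvn0.
  by rewrite ltr_pdivrMr // ltr_pMr // ltr1n.
rewrite f0 sub0r normrN normrE_normc -(addr0 (_ *: v)) dual_linear f0 addr0.
rewrite -[_ *: f v]/(_ * f v) Normc.normcM kC ltcR -ltr_pdivlMl // mulr1 => /ltW fv.
by apply: (le_trans fv); rewrite /k invf_div mulrAC.
Qed.

(** The complement is a union over [v] of preimages of open sets under evaluation at [v]. The centre
    is a bare function, so that [ip n _ d] can be used directly. *)
Lemma weak_closed_ball (R : realType) (V : topologicalLmodType R[i])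
    (h : V -> R[i]) (b : V -> R) :
  opens (weak_topology V) (~` [set f | forall v, normc (f v - h v) <= b v]).
Proof.
have oB v : open [set z : R[i]^o | b v < normc (z - h v)].
  rewrite openE => z /= bz; apply/nbhs_ballP.
  exists (normc (z - h v) - b v)%:C%C; first by rewrite /= ltcR subr_gt0.
  move=> y; rewrite -ball_normE /= normrE_normc ltcR ltrBrDl addrC -ltrBrDl => zy.
  apply: (lt_le_trans zy); rewrite lerBlDr.
  have -> : z - h v = (y - h v) + (z - y) by ring.
  exact: le_normcD.
rewrite [X in opens _ X](_ : _ =
    \bigcup_v [set f : dual V | b v < normc (f v - h v)]); last first.
  apply/seteqP; split=> f /=.
    by move=> /existsNP[v /negP]; rewrite -ltNge; exists v.
  by move=> [v _ /= bv] /(_ v); rewrite leNgt bv.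
rewrite -topologized_open; apply: bigcup_open => v _.
by have [_ /(_ v)/continuousP/(_ _ (oB v))] := weak_topologyP V.
Qed.

Lemma dual_norm_bound (R : realType) (W : normedModType R[i]) (g : dual W) (e : R) :
  (dual_norm g < e%:E)%E -> forall w, normc (g w) <= e * complex.Re `|w|.
Proof.
move=> ge w; have [->|w0] := eqVneq w 0.
  by rewrite dual0 Normc.normc0 normr0 mulr0.
have n0 : 0 < complex.Re `|w| by rewrite -ltcR normv_Re normr_gt0.
pose k := (complex.Re `|w|)^-1; have k0 : 0 < k by rewrite invr_gt0.
have kC : normc k%:C%C = k by apply: complexI; rewrite -normrE_normc ger0_norm // ler0c ltW.
have : ((normc (g (k%:C%C *: w)))%:E <= dual_norm g)%E.
  apply: ereal_sup_ubound; exists (k%:C%C *: w) => //=.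
  by rewrite normrZ normrE_normc kC -normv_Re -rmorphM mulVf // gt_eqF.
move=> /le_lt_trans /(_ ge); rewrite lte_fin -[k%:C%C *: w]addr0 dual_linear.
rewrite dual0 addr0 -[_ *: g w]/(_ * g w) Normc.normcM kC mulrC ltr_pdivrMr //.
exact: ltW.
Qed.

Lemma dual_norm_le (R : realType) (W : normedModType R[i]) (g : dual W) (c : R) :
  0 <= c -> (forall w, normc (g w) <= c * complex.Re `|w|) ->
  (dual_norm g <= c%:E)%E.
Proof.
move=> c0 gc; apply: ge_ereal_sup => _ [w /= w1 <-]; rewrite lee_fin.
apply: (le_trans (gc w)); rewrite ler_piMr //.
by rewrite -lecR normv_Re.
Qed.

(** * Weak measurability of norm-open sets *)

Lemma sigma_algebra_countable_bigcup (T I : Type) (G : set_system T)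
    (D : set I) (A : I -> set T) :
  countable D -> (forall i, D i -> <<s G >> (A i)) ->
  <<s G >> (\bigcup_(i in D) A i).
Proof.
move=> /countable_injP[f finj] GA.
(* The union is reindexed by [nat] through the fibres of [f]; by injectivity each fibre has at most
   one element. *)
pose B k := \bigcup_(i in D `&` f @^-1` [set k]) A i.
have -> : \bigcup_(i in D) A i = \bigcup_k B k.
  apply/seteqP; split=> [x [i Di Aix]|x [k _ [i [Di _] Aix]]]; last by exists i.
  by exists (f i) => //; exists i.
apply: sigma_algebra_bigcup => k.
have [[i [Di fi]]|noi] := pselect (exists i, D i /\ f i = k).
  rewrite /B (_ : D `&` _ = [set i]) ?bigcup_set1; first exact: GA.
  apply/seteqP; split=> [j [Dj /= fj]|_ ->] //.
  by apply: finj; rewrite ?inE // fi fj.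
rewrite /B (_ : D `&` _ = set0) ?bigcup_set0; last first.
  by apply/seteqP; split=> // j [Dj fj]; case: noi; exists j.
by have [] := smallest_sigma_algebra setT G.
Qed.

Section countably_normed_dual.
Variables (R : realType) (V : topologicalLmodType R[i]) (p : nat -> V -> R).
Variable pV : countably_normed p.

Lemma dual_inclusionD n (W : completion (p n)) (f g : dual W) :
  dual_inclusion pV (f + g) = dual_inclusion pV f + dual_inclusion pV g.
Proof. exact: val_inj. Qed.

(** Inside [V'], the space [V_n'] consists of the functionals dominated by a multiple of [p n]. The
    factor 2 comes from [completion_extension]. *)
Lemma dual_lift n (W : completion (p n)) (h : dual V) (c : R) :
  0 <= c -> (forall v, normc (h v) <= c * p n v) ->
  exists2 g : dual W, dual_inclusion pV g = h &
    forall w, normc (g w) <= 2 * c * complex.Re `|w|.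
Proof.
move=> c0 hc.
have [g [gh gc]] :=
  completion_extension _ _ _ W _ _ (dual_linear h) c0 hc.
by exists g => //; apply: val_inj; apply/funext.
Qed.

(** Restates openness in [V_n'] by inequalities on [V], so that the measurability argument can avoid
    computing in the completion. *)
Lemma dual_norm_open_ball n (W : completion (p n)) (U : set (dual V))
    (f : dual V) (c : R) :
  dual_norm_open (@dual_inclusion _ _ _ pV n W @^-1` U) -> U f ->
  0 <= c -> (forall v, normc (f v) <= c * p n v) ->
  exists2 e : R, 0 < e &
    forall g : dual V, (forall v, normc (g v - f v) <= e * p n v) -> U g.
Proof.
move=> oU Uf c0 fc; have [f' f'f _] := dual_lift n W f c c0 fc.
have [|e e0 eU] := oU f'; first by rewrite /= f'f.
(* Lifting doubles the constant to [e / 2], which is strictly below [e]. *)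
exists (e / 4) => [|g ge]; first by rewrite divr_gt0.
have e40 : 0 <= e / 4 by rewrite divr_ge0 // ltW.
have [h' h'E h'e] := dual_lift n W (g - f) (e / 4) e40 ge.
have -> : g = dual_inclusion pV (f' + h').
  by rewrite dual_inclusionD f'f h'E addrC subrK.
apply: eU; rewrite addrC addKr.
apply: (le_lt_trans (dual_norm_le _ _ _ (2 * (e / 4)) _ h'e)); first by rewrite mulr_ge0.
by rewrite lte_fin; lra.
Qed.

End countably_normed_dual.

Lemma norm_open_weakly_measurable (R : realType) (V : topologicalLmodType R[i])
    (p : nat -> V -> R) (pV : countably_normed p)
    (p_ip : forall n, inner_product_norm (p n))
    (p_incr : forall (n : nat) (v : V), p n v <= p n.+1 v)
    (W : forall n, completion (p n))
    (V_sep : exists D : set V, countable D /\ dense D) (U : set (dual V)) :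
  (forall n, dual_norm_open (@dual_inclusion _ _ _ pV n (W n) @^-1` U)) ->
  <<s opens (weak_topology V) >> U.
Proof.
move=> oU; have [D [Dc Dd]] := V_sep.
have p_ge0 n := is_norm_ge0 _ _ _ (countably_normed_norm pV n).
pose ip n := projT1 (cid (p_ip n)).
have ipE n v : ((p n v) ^+ 2)%:C%C = ip n v v by rewrite /ip; case: cid.
pose r k : R := k.+1%:R^-1.
pose ball n d k : set (dual V) :=
  [set f | forall v, normc (f v - ip n v d) <= r k * p n v].
(* A cell is the whole ball if that ball lies in [U], and empty otherwise; a union over all indices
   thus picks out the balls inside [U]. *)
pose cell n d k : set (dual V) := [set f | ball n d k f /\ ball n d k `<=` U].
have -> : U = \bigcup_n \bigcup_(d in D) \bigcup_k cell n d k.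
  apply/seteqP; split=> [f Uf|f [n _ [d _ [k _ [fb]]]]]; last exact.
  have [n [c [c0 fc]]] := dual_bounded _ _ _ f pV p_incr.
  have [e e0 eU] := dual_norm_open_ball _ _ _ pV n (W n) U f c (oU n) Uf c0 fc.
  (* Two elements of a ball differ by at most [2 r k < e]. Half of [r k] is spent on replacing [f]
     by [ip n _ u], half on moving [u] to a point [d] of [D]. *)
  have [k ke] : exists k, r k < e / 2.
    by have [|k] := @ltr_add_invr R 0 (e / 2); [rewrite divr_gt0|rewrite add0r; exists k].
  have rk0 : 0 < r k by rewrite invr_gt0.
  have rk20 : 0 < r k / 2 by rewrite divr_gt0.
  have [u fu] := dense_inner_functionals _ _ (ip n) (p n) (p_ge0 n) (ipE n) f c
    (dual_linear f) fc _ rk20.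
  have [d [Dd' ud]] : exists d, D d /\ p n (u - d) <= r k / 2.
    (* Density is for the topology of [V], in which a [p n]-ball around [u] is a neighborhood of
       [u]. *)
    have [] := Dd [set d | p n (d - u) < r k / 2]^°.
    - exists u; apply/(countably_normed_topology pV).
      by exists [:: n], (r k / 2); split=> // y; apply; exact: mem_head.
    - exact: open_interior.
    move=> d [/interior_subset du Dd']; exists d; split=> //.
    rewrite -opprB -scaleN1r (is_normZ (countably_normed_norm pV n)).
    by rewrite normcN Normc.normc1 mul1r ltW.
  exists n => //; exists d => //; exists k => //.
  have fb : ball n d k f.
    move=> v; have -> : f v - ip n v d = (f v - ip n v u) + ip n v (u - d).
      by rewrite linearBr addrA subrK.
    apply: (le_trans (le_normcD _ _)).
    have -> : r k * p n v = r k / 2 * p n v + r k / 2 * p n v by field.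
    apply: lerD; first exact: fu.
    apply: (le_trans (inner_CauchySchwarz _ _ _ _ (p_ge0 n) (ipE n) _ _)).
    by rewrite mulrC ler_wpM2r.
  split=> // g gb; apply: eU => v.
  have -> : g v - f v = (g v - ip n v d) - (f v - ip n v d) by ring.
  apply: (le_trans (le_normcD _ _)); rewrite normcN.
  apply: (@le_trans _ _ (r k * p n v + r k * p n v)); first exact: lerD.
  by rewrite -mulrDl ler_wpM2r //; lra.
apply: sigma_algebra_bigcup => n; apply: sigma_algebra_countable_bigcup => // d _.
apply: sigma_algebra_bigcup => k.
have [bU|bU] := pselect (ball n d k `<=` U); last first.
  rewrite (_ : cell n d k = set0); last by apply/seteqP; split=> f [].
  by have [] := smallest_sigma_algebra setT (opens (weak_topology V)).
rewrite (_ : cell n d k = setT `\` ~` ball n d k); last first.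
  by rewrite setTD setCK; apply/seteqP; split=> f // [].
by apply: sigma_algebraCD; apply: sub_gen_smallest; exact: weak_closed_ball.
Qed.

(** * Evaluation topologies, and the weak topology below the strong one *)

Section evaluation_topology.
Variables (R : realType) (V : topologicalLmodType R[i]).

Lemma open_is_topology (X : topologicalType) : is_topology (@open X).
Proof.
split=> [|A B|F FO]; [exact: openT|exact: openI|exact: bigcup_open].
Qed.

(** With these, comparisons with the weak topology are made one vector [v] at a time. *)
Definition evaluation_topology (v : V) : topology_on (dual V) :=
  TopologyOn (open_is_topology
    (initial_topology (fun f : dual V => f v : R[i]^o))).

Lemma evaluation_continuous (v : V) :
  continuous (fun f : topologized (evaluation_topology v) => f v : R[i]^o).
Proof. by apply/continuousP => A oA; exists A. Qed.

Lemma continuous_evaluation_topology (X : topologicalType) (v : V)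
    (g : X -> dual V) :
  continuous (fun x => g x v : R[i]^o) ->
  continuous (g : X -> topologized (evaluation_topology v)).
Proof. by move=> /continuousP cg; apply/continuousP => _ [B /cg oB <-]. Qed.

Lemma evaluation_vector_topology (v : V) :
  vector_topology (evaluation_topology v).
Proof.
have cev := @evaluation_continuous v.
split; apply: continuous_evaluation_topology => x.
  apply: (@cvgD R[i] R[i]^o _ (nbhs x) _
    (fun x => x.1 v : R[i]^o) (fun x => x.2 v : R[i]^o)).
    by apply: (@continuous_comp _ (topologized (evaluation_topology v)) R[i]^o fst
      (fun f => f v)); [exact: cvg_fst | exact: cev].
  by apply: (@continuous_comp _ (topologized (evaluation_topology v)) R[i]^o snd
    (fun f => f v)); [exact: cvg_snd | exact: cev].
apply: (@cvgZ R[i] R[i]^o _ (nbhs x) _ (fun x => x.1) (fun x => x.2 v : R[i]^o)).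
  exact: cvg_fst.
by apply: (@continuous_comp _ (topologized (evaluation_topology v)) R[i]^o snd
  (fun f => f v)); [exact: cvg_snd | exact: cev].
Qed.

(** Serves [inductive_limit_topology_finest], which compares with locally convex topologies: a
    convex basis of the scalars is pulled back along a linear map. *)
Lemma evaluation_locally_convex (v : V) :
  locally_convex_topology (evaluation_topology v).
Proof.
have [B Bc [Bo Bb]] := @locally_convex R[i] R[i]^o.
exists [set A | exists2 b, B b & (fun f : dual V => f v : R[i]^o) @^-1` b = A].
  move=> _ /set_mem[b Bb' <-] f g l /set_mem fb /set_mem gb; apply/mem_set.
  have /set_mem := Bc b (mem_set Bb') (f v) (g v) l (mem_set fb) (mem_set gb).
  exact.
split=> [_ [b /Bo ob <-]|f A]; first by exists b.
rewrite nbhsE => -[_ [[C oC <-] Cf] CA].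
have [b [Bb' bf] bC] := Bb (f v) C (open_nbhs_nbhs (conj oC Cf)).
exists ((fun f : dual V => f v : R[i]^o) @^-1` b); first by split=> //; exists b.
by move=> g bg; apply: CA; exact: bC.
Qed.

Lemma weak_sub_evaluation :
  opens (weak_topology V) `<=` opens (Defs.sup_topology (range evaluation_topology)).
Proof.
apply: weak_topology_coarsest.
  by apply: sup_vector_topology => _ [v _ <-]; exact: evaluation_vector_topology.
move=> v; apply/continuousP => A oA.
apply: (@sub_sup_topology _ _ (evaluation_topology v)); first by exists v.
by exists A.
Qed.

(** The supremum of the evaluation topologies lies in between, and it is this supremum, rather than
    [T], that is shown to be a vector topology. *)
Lemma weak_sub (T : topology_on (dual V)) :
  (forall v, opens (evaluation_topology v) `<=` opens T) ->
  opens (weak_topology V) `<=` opens T.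
Proof.
move=> eT; apply: subset_trans weak_sub_evaluation _.
apply: smallest_sub; first exact: opens_topology.
by move=> A [_ [v _ <-]]; exact: eT.
Qed.

(** By continuity of scaling at [(0, v)], a small positive multiple of [v] lies in [U]. *)
Lemma tvs_bounded1 (v : V) : tvs_bounded [set v].
Proof.
move=> U U0; have := @scale_continuous _ V (0, v) U; rewrite /= scale0r.
move=> /(_ U0)[[A B] /= [/nbhs_ballP[d /= d0 dA] /nbhs_singleton Bv] ABU].
have d20 : 0 < d / 2 by rewrite divr_gt0.
exists (d / 2)^-1; first by rewrite invr_gt0.
move=> _ ->; exists ((d / 2) *: v); last by rewrite scalerA mulVf ?scale1r ?gt_eqF.
apply: (ABU (d / 2, v)); split=> //=; apply: dA.
rewrite -ball_normE /= sub0r normrN gtr0_norm //.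
by rewrite ltr_pdivrMr // ltr_pMr // ltr1n.
Qed.

Lemma evaluation_sub_strong (v : V) :
  opens (evaluation_topology v) `<=` opens (strong_topology V).
Proof.
move=> _ [B oB <-] f Bf.
have /nbhs_ballP[[e e'] /= e0 eB] : nbhs (f v : R[i]^o) B.
  exact: open_nbhs_nbhs.
have /andP[/eqP /= e'0 Ree] : (e' == 0) && (0 < e) by move: e0; rewrite ltcE.
exists [set v], e; split=> // [|g]; first exact: tvs_bounded1.
rewrite /strong_nbhs0 /= image_set1 ereal_sup1 lte_fin => ge; apply: eB.
by rewrite -ball_normE /= e'0 distrC normrE_normc ltcR.
Qed.

Lemma weak_sub_strong : opens (weak_topology V) `<=` opens (strong_topology V).
Proof. by apply: weak_sub => v; exact: evaluation_sub_strong. Qed.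

End evaluation_topology.

(** * Continuity of the inclusions of [V_n'] into [V'] *)

Section inclusions.
Variables (R : realType) (V : topologicalLmodType R[i]) (p : nat -> V -> R).
Variable pV : countably_normed p.

Lemma Re_norm_completion n (W : completion (p n)) v :
  complex.Re `|completion_map W v| = p n v.
Proof. by rewrite completion_isometry. Qed.

(** A bounded [D] lies in a multiple [l] of the unit ball of [p n], so the supremum over [D] is at
    most [|l|] times the dual norm. *)
Lemma dual_inclusion_strong n (W : completion (p n)) :
  continuous (@dual_inclusion _ _ _ pV n W :
    topologized (dual_norm_topology W) -> topologized (strong_topology V)).
Proof.
apply/continuousP => U; rewrite !topologized_open => oU f /oU[D [e [bD e0 DU]]].
have [|l l0 Dl] := bD [set v | p n v < 1].
  apply/(countably_normed_topology pV); exists [:: n], 1; split=> // y.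
  by move=> /(_ _ (mem_head _ _)); rewrite subr0.
have l1 : 0 < normc l + 1 by rewrite ltr_wpDl // normc_ge0.
(* A supremum of values [<= e / 2] is strictly below [e]. *)
exists (e / 2 / (normc l + 1)); first by rewrite !divr_gt0.
move=> g /dual_norm_bound gf; apply: DU; rewrite /strong_nbhs0 /=.
apply: (@le_lt_trans _ _ (e / 2)%:E); last by rewrite lte_fin; lra.
apply: ge_ereal_sup => _ [v /Dl[u /= pu <-] <-]; rewrite lee_fin.
apply: (le_trans (gf _)); rewrite Re_norm_completion.
rewrite (is_normZ (countably_normed_norm pV n)) -[leLHS]mulrA.
rewrite ler_piMr ?divr_ge0 ?(ltW e0) // mulrC ler_pdivrMr // mul1r.
apply: (@le_trans _ _ (normc l)); last by rewrite lerDl.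
by rewrite ler_piMr ?normc_ge0 // ltW.
Qed.

Lemma dual_inclusion_evaluation n (W : completion (p n)) v :
  continuous (@dual_inclusion _ _ _ pV n W :
    topologized (dual_norm_topology W) -> topologized (evaluation_topology _ _ v)).
Proof.
have /continuousP inc := @dual_inclusion_strong n W.
by apply/continuousP => A evA; apply: inc; exact: evaluation_sub_strong evA.
Qed.

Lemma weak_sub_inductive_limit (W : forall n, completion (p n)) :
  opens (weak_topology V) `<=` opens (inductive_limit_topology pV W).
Proof.
apply: weak_sub => v; apply: inductive_limit_topology_finest.
- exact: evaluation_vector_topology.
- exact: evaluation_locally_convex.
- by move=> n; exact: dual_inclusion_evaluation.
Qed.

End inclusions.

(** * Equality of the three sigma-fields *)

Theorem corollary7p6 (R : realType) (V : topologicalLmodType R[i])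
    (p : nat -> V -> R) (pV : countably_Hilbert p)
    (p_incr : forall (n : nat) (v : V), p n v <= p n.+1 v)
    (W : forall n, completion (p n))
    (V_sep : exists D : set V, countable D /\ dense D) :
  <<s opens (inductive_limit_topology (countably_Hilbert_normed pV) W) >> =
    <<s opens (strong_topology V) >> /\
  <<s opens (strong_topology V) >> = <<s opens (weak_topology V) >>.
Proof.
set q := countably_Hilbert_normed pV.
(* One argument serves both topologies: open sets of [T] are norm-open on each [V_n'], hence weakly
   measurable, and [T] contains the weakly open sets. *)
have sub (T : topology_on (dual V)) :
    (forall n, continuous (@dual_inclusion _ _ _ q n (W n) :
      topologized (dual_norm_topology (W n)) -> topologized T)) ->
    opens (weak_topology V) `<=` opens T ->
    <<s opens T >> = <<s opens (weak_topology V) >>.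
  move=> incT wT; apply/seteqP; split.
    apply: smallest_sub; first exact: smallest_sigma_algebra.
    move=> U TU; apply: (norm_open_weakly_measurable _ _ _ q
      (countably_Hilbert_inner pV) p_incr W V_sep) => n.
    by have /continuousP/(_ U TU) := incT n.
  by apply: sub_smallest2r.
have st := sub _ (fun n => dual_inclusion_strong _ _ _ q n (W n)) (@weak_sub_strong _ _).
have [_ _ il] := inductive_limit_topologyP q W.
rewrite (sub _ il (weak_sub_inductive_limit _ _ _ q W)).
by rewrite st.
Qed.
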